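(* Let $\{\hat{\boldsymbol\beta}^k,\hat{\boldsymbol r}^k,\hat{\boldsymbol u}^k\}$ be the iterates of Algorithm 1 (single machine) and $\{\bar{\boldsymbol\beta}^k,\bar{\boldsymbol r}^k,\bar{\boldsymbol u}^k\}$ the iterates of Algorithm 2 (data partitioned across $G$ machines), both described in the context, applied to the same data. If the two algorithms use the same initial iterates $\{\hat{\boldsymbol\beta}^0,\hat{\boldsymbol r}^0,\hat{\boldsymbol u}^0\}=\{\bar{\boldsymbol\beta}^0,\bar{\boldsymbol r}^0,\bar{\boldsymbol u}^0\}$ and the same parameter $\eta$, then $$\{\hat{\boldsymbol\beta}^k,\hat{\boldsymbol r}^k,\hat{\boldsymbol u}^k\}=\{\bar{\boldsymbol\beta}^k,\bar{\boldsymbol r}^k,\bar{\boldsymbol u}^k\}\quad\text{for all }k.$$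
   Context: Data and common parameters: $\boldsymbol X\in\mathbb R^{n\times d}$, $\boldsymbol S\in\mathbb R^n$, an integer $m\ge1$, $\lambda>0$, a weight vector $\boldsymbol w\in\mathbb R^d$ with positive entries, $\mu>0$, $\eta>0$, $c_0>0$. Let $\phi(t)=m\log(1+\exp(t))$; for a vector $\boldsymbol r$, $\phi'(\boldsymbol r)$ is the vector of entries $\phi'(r_i)$ and $\Phi(\boldsymbol r)$ the diagonal matrix with diagonal entries $\phi''(r_i)+c_0$. $\odot$ is the entrywise product; $\mathrm{sign}$, $|\cdot|$ and $(\cdot)_+=\max(\cdot,0)$ act entrywise. Algorithm 1: given $(\boldsymbol\beta^k,\boldsymbol r^k,\boldsymbol u^k)\in\mathbb R^d\times\mathbb R^n\times\mathbb R^n$, put $\boldsymbol a^k=\boldsymbol\beta^k-\frac{\mu\boldsymbol X^\top(\boldsymbol X\boldsymbol\beta^k-\boldsymbol r^k-\boldsymbol u^k/\mu)}{\eta}$ and $$\boldsymbol\beta^{k+1}=\mathrm{sign}(\boldsymbol a^k)\odot\big(|\boldsymbol a^k|-\lambda\boldsymbol w/\eta\big)_+,$$ $$\boldsymbol r^{k+1}=[\Phi(\boldsymbol r^k)+\mu\boldsymbol I_n]^{-1}\big[\mu(\boldsymbol X\boldsymbol\beta^{k+1}-\boldsymbol u^k/\mu)+\Phi(\boldsymbol r^k)\boldsymbol r^k-\phi'(\boldsymbol r^k)+\boldsymbol S\big],$$ $$\boldsymbol u^{k+1}=\boldsymbol u^k-\mu(\boldsymbol X\boldsymbol\beta^{k+1}-\boldsymbol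 r^{k+1}).$$ Algorithm 2: the rows are partitioned into $G$ consecutive blocks of sizes $n_1,\dots,n_G$ with $\sum_gn_g=n$: $\boldsymbol X=(\boldsymbol X_1^\top,\dots,\boldsymbol X_G^\top)^\top$, $\boldsymbol S=(\boldsymbol S_1^\top,\dots,\boldsymbol S_G^\top)^\top$, and correspondingly $\boldsymbol r=(\boldsymbol r_1^\top,\dots,\boldsymbol r_G^\top)^\top$, $\boldsymbol u=(\boldsymbol u_1^\top,\dots,\boldsymbol u_G^\top)^\top$, with $\boldsymbol X_g\in\mathbb R^{n_g\times d}$ and $\boldsymbol S_g,\boldsymbol r_g,\boldsymbol u_g\in\mathbb R^{n_g}$. Given the $k$-th iterates, put $\boldsymbol\xi_g^k=\frac{\mu\boldsymbol X_g^\top(\boldsymbol X_g\boldsymbol\beta^k-\boldsymbol r_g^k-\boldsymbol u_g^k/\mu)}{\eta}$. The central machine computes $$\boldsymbol\beta^{k+1}=\mathrm{sign}\Big(\boldsymbol\beta^k-\sum_{g=1}^G\boldsymbol\xi_g^k\Big)\odot\Big(\Big|\boldsymbol\beta^k-\sum_{g=1}^G\boldsymbol\xi_g^k\Big|-\frac{\lambda\boldsymbol w}{\eta}\Big)_+,$$ and then each local machine $g=1,\dots,G$ computes $$\boldsymbol r_g^{k+1}=[\Phi(\boldsymbol r_g^k)+\mu\boldsymbol I_{n_g}]^{-1}\big[\mu(\boldsymbol X_g\boldsymbol\beta^{k+1}-\boldsymbol u_g^k/\mu)+\Phi(\boldsymbol r_g^k)\boldsymbol r_g^k-\phi'(\boldsymbol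 r_g^k)+\boldsymbol S_g\big],$$ $$\boldsymbol u_g^{k+1}=\boldsymbol u_g^k-\mu(\boldsymbol X_g\boldsymbol\beta^{k+1}-\boldsymbol r_g^{k+1}).$$ *)

(* Defs.v *)
(* MathComp-Analysis *)
From mathcomp Require Import all_boot all_order all_algebra.
From mathcomp Require Import classical_sets reals topology normedtype.
From mathcomp Require Import sequences derive exp.
Set Implicit Arguments.
Unset Strict Implicit.
Unset Printing Implicit Defensive.
Import Order.TTheory GRing.Theory Num.Theory.
Import numFieldNormedType.Exports.
Local Open Scope ring_scope.

Section Updates.
Context {R : realType}.

Definition phi (m : nat) (t : R) : R := m%:R * ln (1 + expR t).

Definition phi' (m n : nat) (r : 'cV[R]_n) : 'cV[R]_n := map_mx ((phi m)^`()%classic) r.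

Definition Phi (m : nat) (c0 : R) (n : nat) (r : 'cV[R]_n) : 'M[R]_n :=
  diag_mx (\row_i ((phi m)^`(2)%classic (r i 0) + c0)).

Definition soft_threshold (d : nat) (a t : 'cV[R]_d) : 'cV[R]_d :=
  map2_mx *%R (map_mx Num.sg a)
    (map_mx (fun x => Num.max x 0) (map_mx Num.norm a - t)).

Definition xi (mu eta : R) (n d : nat) (X : 'M[R]_(n, d)) (beta : 'cV[R]_d)
    (r u : 'cV[R]_n) : 'cV[R]_d :=
  eta^-1 *: (mu *: (X^T *m (X *m beta - r - mu^-1 *: u))).

Definition r_update (m : nat) (mu c0 : R) (n d : nat)
    (X : 'M[R]_(n, d)) (S : 'cV[R]_n)
    (beta_new : 'cV[R]_d) (r u : 'cV[R]_n) : 'cV[R]_n :=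
  invmx (Phi m c0 r + mu%:M) *m
    (mu *: (X *m beta_new - mu^-1 *: u) + Phi m c0 r *m r - phi' m r + S).

Definition u_update (mu : R) (n d : nat) (X : 'M[R]_(n, d))
    (beta_new : 'cV[R]_d) (r_new u : 'cV[R]_n) : 'cV[R]_n :=
  u - mu *: (X *m beta_new - r_new).

End Updates.

Record iterate1 (R : realType) (n d : nat) := Iterate1 {
  beta1 : 'cV[R]_d;
  r1 : 'cV[R]_n;
  u1 : 'cV[R]_n }.

Definition step1 (R : realType) (n d m : nat) (lambda : R) (w : 'cV[R]_d)
    (mu eta c0 : R) (X : 'M[R]_(n, d)) (S : 'cV[R]_n)
    (z : iterate1 R n d) : iterate1 R n d :=
  let a := beta1 z - xi mu eta X (beta1 z) (r1 z) (u1 z) in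
  let beta := soft_threshold a (eta^-1 *: (lambda *: w)) in
  let r := r_update m mu c0 X S beta (r1 z) (u1 z) in
  let u := u_update mu X beta r (u1 z) in
  Iterate1 beta r u.

Definition algorithm1 (R : realType) (n d m : nat) (lambda : R)
    (w : 'cV[R]_d) (mu eta c0 : R) (X : 'M[R]_(n, d)) (S : 'cV[R]_n)
    (z0 : iterate1 R n d) (k : nat) : iterate1 R n d :=
  iter k (step1 m lambda w mu eta c0 X S) z0.

Record iterate2 (R : realType) (G : nat) (n_ : 'I_G -> nat) (d : nat) :=
  Iterate2 {
    beta2 : 'cV[R]_d;
    r2 : forall g, 'cV[R]_(n_ g);
    u2 : forall g, 'cV[R]_(n_ g) }.

Definition step2 (R : realType) (G : nat) (n_ : 'I_G -> nat) (d m : nat)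
    (lambda : R) (w : 'cV[R]_d) (mu eta c0 : R)
    (X_ : forall g, 'M[R]_(n_ g, d)) (S_ : forall g, 'cV[R]_(n_ g))
    (z : iterate2 R n_ d) : iterate2 R n_ d :=
  let a := beta2 z - \sum_(g < G) xi mu eta (X_ g) (beta2 z) (r2 z g) (u2 z g) in
  let beta := soft_threshold a (eta^-1 *: (lambda *: w)) in
  let r g := r_update m mu c0 (X_ g) (S_ g) beta (r2 z g) (u2 z g) in
  let u g := u_update mu (X_ g) beta (r g) (u2 z g) in
  Iterate2 beta r u.

Definition algorithm2 (R : realType) (G : nat) (n_ : 'I_G -> nat) (d m : nat)
    (lambda : R) (w : 'cV[R]_d) (mu eta c0 : R)
    (X_ : forall g, 'M[R]_(n_ g, d)) (S_ : forall g, 'cV[R]_(n_ g))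
    (z0 : iterate2 R n_ d) (k : nat) : iterate2 R n_ d :=
  iter k (step2 m lambda w mu eta c0 X_ S_) z0.

(* \mxcol keeps the blocks consecutive, in increasing order of g, and is
   inverse to submxcol, which extracts the g-th row block. *)
Definition stack (R : realType) (G : nat) (n_ : 'I_G -> nat) (d : nat)
    (z : iterate2 R n_ d) : iterate1 R (\sum_(g < G) n_ g) d :=
  Iterate1 (beta2 z) (\mxcol_(g < G) r2 z g) (\mxcol_(g < G) u2 z g).

(* Main.v *)
(* The only nonlocal operation in Algorithm 1 is X^T v, which is the sum over
   the blocks of X_g^T v_g.  In the r-update the matrix Phi(r) + mu I is
   diagonal, and convexity of phi makes its diagonal positive, hence nonzero.
   It is therefore inverted entry by entry, so that, given beta^{k+1}, each
   row of r^{k+1} only depends on the same row of X, S, r^k and u^k. *)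
Require Import Defs.
From mathcomp Require Import all_boot all_order all_algebra.
From mathcomp Require Import reals.
From mathcomp Require Import boolp classical_sets normedtype.
From mathcomp Require Import sequences derive realfun exp.
Import Order.TTheory GRing.Theory Num.Theory.
Import numFieldNormedType.Exports.
Local Open Scope ring_scope.

Lemma is_derive_1DexpR {R : realType} (t : R) :
  is_derive t 1 (fun x : R => 1 + expR x) (expR t).
Proof.
by rewrite -[expR t]add0r; exact: is_deriveD (is_derive_cst _ _ _) _.
Qed.

(** The logistic function is kept as $1 - 1/(1+e^t)$ instead of $e^t/(1+e^t)$, so that
    differentiating it again only takes the rule for an inverse. *)
Lemma derive1_phi (R : realType) (m : nat) :
  (@phi R m)^`()%classic = fun t => m%:R * (1 - (1 + expR t)^-1).
Proof.
apply/funext => t; rewrite derive1E.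
have e0 : 0 < 1 + expR t by rewrite addr_gt0 ?expR_gt0.
have dln : is_derive t 1 (fun x : R => ln (1 + expR x))
    ((1 + expR t)^-1 * expR t).
  exact: (is_derive1_comp (g := fun x => 1 + expR x)) (is_derive1_ln e0)
    (is_derive_1DexpR t).
rewrite (@derive_val _ _ _ _ _ _ _ (is_deriveZ m%:R dln)).
congr (_ * _).
(* The leading $1$ is written as $(1+e^t)^{-1}(1+e^t)$ to factor out the inverse. *)
rewrite -[X in X - _](mulVf (lt0r_neq0 e0)).
by rewrite -[X in _ - X]mulr1 -mulrBr [1 + _]addrC addrK.
Qed.

(** The second derivative is $m e^t/(1+e^t)^2$. *)
Lemma phi''_ge0 (R : realType) (m : nat) (t : R) :
  0 <= (phi m)^`(2)%classic t.
Proof.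
rewrite derive1nS derive1n1 derive1_phi derive1E.
have e0 : 0 < 1 + expR t by rewrite addr_gt0 ?expR_gt0.
have dV := is_deriveV (f := fun x => 1 + expR x) (lt0r_neq0 e0)
  (is_derive_1DexpR t).
have d1 := is_deriveB (is_derive_cst (1 : R) t 1) dV.
rewrite (@derive_val _ _ _ _ _ _ _ (is_deriveZ m%:R d1)) sub0r scaleNr opprK.
by rewrite !mulr_ge0 ?ler0n ?expR_ge0// invr_ge0 exprn_ge0// ltW.
Qed.

Lemma invmx_diag {F : fieldType} {n : nat} (D : 'rV[F]_n) :
  (forall i, D 0 i != 0) -> invmx (diag_mx D) = diag_mx (map_mx GRing.inv D).
Proof.
move=> D0; have DV : diag_mx D *m diag_mx (map_mx GRing.inv D) = 1%:M.
  rewrite mulmx_diag -diag_const_mx; congr diag_mx.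
  by apply/rowP => i; rewrite !mxE divff.
(* A one-sided inverse of a square matrix makes it a unit; [invmx] is a genuine inverse only on
   units. *)
have [U _] := mulmx1_unit DV.
by rewrite -[RHS]mul1mx -(mulVmx U) -mulmxA DV mulmx1.
Qed.

Section BlockUpdates.
Context {R : realType}.

Lemma r_updateE (m : nat) (mu c0 : R) (n d : nat) (X : 'M[R]_(n, d))
    (S : 'cV[R]_n) (b : 'cV[R]_d) (r u : 'cV[R]_n) (i : 'I_n) :
  0 < mu -> 0 < c0 ->
  r_update m mu c0 X S b r u i 0 =
    ((phi m)^`(2)%classic (r i 0) + c0 + mu)^-1 *
    (mu * ((X *m b) i 0 - mu^-1 * u i 0)
      + ((phi m)^`(2)%classic (r i 0) + c0) * r i 0
      - (phi m)^`()%classic (r i 0) + S i 0).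
Proof.
move=> mu0 c00; rewrite /r_update /Phi -diag_const_mx -linearD /= invmx_diag.
  by rewrite !mul_diag_mx !mxE.
(* The diagonal entry $\phi''(r_j) + c_0 + \mu$ is positive. *)
by move=> j; rewrite !mxE gt_eqF// addr_gt0// ltr_wpDl// phi''_ge0.
Qed.

Lemma submxcol_r_update (m : nat) (mu c0 : R) (G : nat) (n_ : 'I_G -> nat)
    (d : nat) (X : 'M[R]_(\sum_(g < G) n_ g, d)) (b : 'cV[R]_d)
    (S r u : 'cV[R]_(\sum_(g < G) n_ g)) (g : 'I_G) :
  0 < mu -> 0 < c0 ->
  submxcol (r_update m mu c0 X S b r u) g =
    r_update m mu c0 (submxcol X g) (submxcol S g) b
      (submxcol r g) (submxcol u g).
Proof.
move=> mu0 c00; apply/colP => i.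
by rewrite [LHS]mxE !r_updateE// submxcol_mul !mxE.
Qed.

Lemma submxcol_u_update (mu : R) (G : nat) (n_ : 'I_G -> nat) (d : nat)
    (X : 'M[R]_(\sum_(g < G) n_ g, d)) (b : 'cV[R]_d)
    (r u : 'cV[R]_(\sum_(g < G) n_ g)) (g : 'I_G) :
  submxcol (u_update mu X b r u) g =
    u_update mu (submxcol X g) b (submxcol r g) (submxcol u g).
Proof. by apply/colP => i; rewrite /u_update submxcol_mul !mxE. Qed.

Lemma xi_sum_blocks (mu eta : R) (G : nat) (n_ : 'I_G -> nat) (d : nat)
    (X : 'M[R]_(\sum_(g < G) n_ g, d)) (b : 'cV[R]_d)
    (r u : forall g, 'cV[R]_(n_ g)) :
  xi mu eta X b (\mxcol_g r g) (\mxcol_g u g) =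
    \sum_(g < G) xi mu eta (submxcol X g) b (r g) (u g).
Proof.
rewrite /xi -!scaler_sumr; congr (_ *: (_ *: _)).
(* Both [X] and the residual vector are cut into row blocks: the transpose becomes a row of blocks,
   and its product with a column of blocks is a sum over $g$. *)
rewrite -[X in X^T]submxcolK tr_mxcol -[X in _ *m X]submxcolK mul_mxrow_mxcol.
apply: eq_bigr => g _; rewrite submxcol_mul; congr (_ *m _).
rewrite -[in RHS](mxcolK r g) -[in RHS](mxcolK u g).
by apply/colP => i; rewrite !mxE.
Qed.

Lemma step1_stack (G : nat) (n_ : 'I_G -> nat) (d m : nat) (lambda : R)
    (w : 'cV[R]_d) (mu eta c0 : R) (X : 'M[R]_(\sum_(g < G) n_ g, d))
    (S : 'cV[R]_(\sum_(g < G) n_ g)) (z : iterate2 R n_ d) :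
  0 < mu -> 0 < c0 ->
  step1 m lambda w mu eta c0 X S (stack z) =
    stack (step2 m lambda w mu eta c0 (submxcol X) (submxcol S) z).
Proof.
move=> mu0 c00; rewrite /step1 /step2 /stack /= xi_sum_blocks.
(* Both algorithms now threshold the same vector, so the remaining updates are compared for one
   common [b]. *)
set b := soft_threshold _ _.
have rE : r_update m mu c0 X S b (\mxcol_g r2 z g) (\mxcol_g u2 z g) =
    \mxcol_g r_update m mu c0 (submxcol X g) (submxcol S g) b
               (r2 z g) (u2 z g).
  by apply/mxcolP => g; rewrite mxcolK submxcol_r_update ?mxcolK.
(* The [u]-update uses the new [r], so the latter must be in stacked form first. *)
rewrite rE; congr Iterate1; apply/mxcolP => g.
by rewrite submxcol_u_update !mxcolK.
Qed.

End BlockUpdates.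

Theorem theorem4 (R : realType) (G : nat) (n_ : 'I_G -> nat) (d m : nat)
    (X : 'M[R]_(\sum_(g < G) n_ g, d)) (S : 'cV[R]_(\sum_(g < G) n_ g))
    (lambda : R) (w : 'cV[R]_d) (mu eta c0 : R)
    (m_ge1 : (1 <= m)%N) (lambda_gt0 : 0 < lambda)
    (w_gt0 : forall j, 0 < w j 0)
    (mu_gt0 : 0 < mu) (eta_gt0 : 0 < eta) (c0_gt0 : 0 < c0)
    (zhat0 : iterate1 R (\sum_(g < G) n_ g) d) (zbar0 : iterate2 R n_ d)
    (same_init : zhat0 = stack zbar0) :
  let zhat := algorithm1 m lambda w mu eta c0 X S zhat0 in
  let zbar := algorithm2 m lambda w mu eta c0
                (fun g => submxcol X g) (fun g => submxcol S g) zbar0 in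
  forall k : nat,
    [/\ beta1 (zhat k) = beta2 (zbar k),
        r1 (zhat k) = \mxcol_(g < G) r2 (zbar k) g
      & u1 (zhat k) = \mxcol_(g < G) u2 (zbar k) g].
Proof.
move=> zhat zbar k.
(* The three equations are the fields of a single equality of records, which is what the induction
   carries. *)
suff -> : zhat k = stack (zbar k) by [].
elim: k => [//|k IH].
rewrite -[LHS]/(step1 m lambda w mu eta c0 X S (zhat k)) IH.
exact: step1_stack.
Qed.
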